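(* Let $\Gamma$ be an $l$-regular triangle-free finite simplicial graph with $n$ vertices, $n\ge 4$. The geodesic growth series of the right-angled Coxeter group based on $\Gamma$ (with respect to the standard generating set $V\Gamma$) is $$\mathcal{G}(z)=\frac{1-(l-3)z+2z^2}{1+(-n-l+3)z+(-2n+2+nl)z^2}.$$
   Context: A graph is $l$-regular if every vertex has exactly $l$ neighbours, and triangle-free if no three vertices span a complete graph. The right-angled Coxeter group based on $\Gamma$ is $\langle s\in V\Gamma \mid s^2=1\ \forall s\in V\Gamma,\ (ss')^2=1\ \forall \{s,s'\}\in E\Gamma\rangle$. For a group $G$ generated by a finite set $S$, with natural projection $\pi\colon S^*\to G$ from the free monoid and word length $|\cdot|$ on $G$, the geodesic growth series is the formal power series $\mathcal{G}(z)=\sum_{r\ge 0}|\{w\in S^*: |w|=|\pi(w)|=r\}|\,z^r$. *)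

(* Defs.v *)
From HB Require Import structures.
From mathcomp Require Import all_boot all_order all_algebra.
From mathcomp Require Import boolp.

Set Implicit Arguments.
Unset Strict Implicit.
Unset Printing Implicit Defensive.

Import GRing.Theory.

Set Warnings "-redundant-canonical-projection".

(** * Groups given by a presentation *)

(* The letter [(s, false)] stands for [s] and [(s, true)] for its formal
   inverse. *)
Definition gword (S : Type) := seq (S * bool).

Definition letter (S : Type) (s : S) : gword S := [:: (s, false)].

Definition flip_letter (S : Type) (a : S * bool) : S * bool := (a.1, ~~ a.2).

Definition gword_exp (S : Type) (w : gword S) (k : nat) : gword S :=
  flatten (nseq k w).

Definition gword_inv (S : Type) (w : gword S) : gword S :=
  rev (map (@flip_letter S) w).

Inductive pres_equiv (S : Type) (R : gword S -> Prop) :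
    gword S -> gword S -> Prop :=
| pres_refl w : pres_equiv R w w
| pres_sym w1 w2 : pres_equiv R w1 w2 -> pres_equiv R w2 w1
| pres_trans w1 w2 w3 :
    pres_equiv R w1 w2 -> pres_equiv R w2 w3 -> pres_equiv R w1 w3
| pres_cancel u a v : pres_equiv R (u ++ [:: a; flip_letter a] ++ v) (u ++ v)
| pres_relator u r v : R r -> pres_equiv R (u ++ r ++ v) (u ++ v).

Definition pres_rel (S : Type) (R : gword S -> Prop) : rel (gword S) :=
  fun u v => `[< pres_equiv R u v >].

Lemma pres_rel_refl (S : Type) (R : gword S -> Prop) : reflexive (pres_rel R).
Proof. by move=> w; apply/asboolP; apply: pres_refl. Qed.

Lemma pres_rel_sym (S : Type) (R : gword S -> Prop) : symmetric (pres_rel R).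
Proof. by move=> u v; apply/asboolP/asboolP; apply: pres_sym. Qed.

Lemma pres_rel_trans (S : Type) (R : gword S -> Prop) :
  transitive (pres_rel R).
Proof.
by move=> v u w /asboolP uv /asboolP vw; apply/asboolP; apply: pres_trans vw.
Qed.

Canonical pres_rel_equiv (S : Type) (R : gword S -> Prop) :=
  EquivRel (pres_rel R) (@pres_rel_refl S R) (@pres_rel_sym S R)
    (@pres_rel_trans S R).

Definition presented_group (S : choiceType) (R : gword S -> Prop) : Type :=
  {eq_quot (pres_rel R)}%qT.

HB.instance Definition _ (S : choiceType) (R : gword S -> Prop) :=
  EqQuotient.copy (presented_group R) {eq_quot (pres_rel R)}%qT.
HB.instance Definition _ (S : choiceType) (R : gword S -> Prop) :=
  Choice.copy (presented_group R) {eq_quot (pres_rel R)}%qT.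

Definition pres_class (S : choiceType) (R : gword S -> Prop) (w : gword S) :
  presented_group R := \pi_({eq_quot (pres_rel R)})%qT w.

Lemma pres_classP (S : choiceType) (R : gword S -> Prop) (u v : gword S) :
  pres_class R u = pres_class R v <-> pres_equiv R u v.
Proof.
split=> [/eqP|uv]; first by rewrite eqmodE => /asboolP.
by apply/eqP; rewrite eqmodE; apply/asboolP.
Qed.

Lemma pres_classK (S : choiceType) (R : gword S -> Prop)
    (x : presented_group R) : pres_class R (repr x) = x.
Proof. exact: reprK. Qed.

Lemma pres_equiv_catl (S : Type) (R : gword S -> Prop) (w u v : gword S) :
  pres_equiv R u v -> pres_equiv R (w ++ u) (w ++ v).
Proof.
elim=> {u v} [u|u v _|u v x _ uv _ vx|u a v|u r v Rr].
- exact: pres_refl.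
- exact: pres_sym.
- exact: pres_trans vx.
- by rewrite !(catA w); apply: pres_cancel.
- by rewrite !(catA w); apply: pres_relator.
Qed.

Lemma pres_equiv_catr (S : Type) (R : gword S -> Prop) (w u v : gword S) :
  pres_equiv R u v -> pres_equiv R (u ++ w) (v ++ w).
Proof.
elim=> {u v} [u|u v _|u v x _ uv _ vx|u a v|u r v Rr].
- exact: pres_refl.
- exact: pres_sym.
- exact: pres_trans vx.
- by rewrite -!catA; apply: pres_cancel.
- by rewrite -!catA; apply: pres_relator.
Qed.

Lemma pres_equiv_invl (S : Type) (R : gword S -> Prop) (w : gword S) :
  pres_equiv R (gword_inv w ++ w) [::].
Proof.
elim: w => [|[s b] w IHw]; first exact: pres_refl.
rewrite /gword_inv /= rev_cons cat_rcons.
apply: pres_trans IHw.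
have := pres_cancel R (gword_inv w) (flip_letter (s, b)) w.
by rewrite /flip_letter /= negbK.
Qed.

Lemma gword_invK (S : Type) : involutive (@gword_inv S).
Proof.
move=> w; rewrite /gword_inv map_rev revK -map_comp -[RHS]map_id.
by apply: eq_map => -[s b]; rewrite /flip_letter /= negbK.
Qed.

Lemma pres_equiv_inv (S : Type) (R : gword S -> Prop) (u v : gword S) :
  pres_equiv R u v -> pres_equiv R (gword_inv u) (gword_inv v).
Proof.
move=> uv.
apply: pres_trans (_ : pres_equiv R (gword_inv u ++ (v ++ gword_inv v)) _).
  rewrite -[X in pres_equiv _ X _]cats0; apply/pres_equiv_catl/pres_sym.
  by rewrite -{1}[v]gword_invK; apply: pres_equiv_invl.
rewrite catA -[X in pres_equiv _ _ X]cat0s; apply: pres_equiv_catr.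
apply: pres_trans (pres_equiv_invl R u).
exact/pres_equiv_catl/pres_sym.
Qed.

Definition pres_one (S : choiceType) (R : gword S -> Prop) :
  presented_group R := pres_class R [::].

Definition pres_mul (S : choiceType) (R : gword S -> Prop)
  (x y : presented_group R) : presented_group R :=
  pres_class R (repr x ++ repr y).

Definition pres_inv (S : choiceType) (R : gword S -> Prop)
  (x : presented_group R) : presented_group R :=
  pres_class R (gword_inv (repr x)).

Lemma pres_mulE (S : choiceType) (R : gword S -> Prop) (u v : gword S) :
  pres_mul (pres_class R u) (pres_class R v) = pres_class R (u ++ v).
Proof.
apply/pres_classP.
apply: pres_trans (_ : pres_equiv R (repr (pres_class R u) ++ v) _).
  by apply/pres_equiv_catl/pres_classP; rewrite pres_classK.
by apply/pres_equiv_catr/pres_classP; rewrite pres_classK.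
Qed.

Lemma pres_invE (S : choiceType) (R : gword S -> Prop) (u : gword S) :
  pres_inv (pres_class R u) = pres_class R (gword_inv u).
Proof.
by apply/pres_classP/pres_equiv_inv/pres_classP; rewrite pres_classK.
Qed.

Lemma pres_mulA (S : choiceType) (R : gword S -> Prop) :
  associative (@pres_mul S R).
Proof.
move=> x y z; rewrite -(pres_classK x) -(pres_classK y) -(pres_classK z).
by rewrite !pres_mulE catA.
Qed.

Lemma pres_mul1 (S : choiceType) (R : gword S -> Prop) :
  left_id (pres_one R) (@pres_mul S R).
Proof. by move=> x; rewrite -(pres_classK x) pres_mulE. Qed.

Lemma pres_mulr1 (S : choiceType) (R : gword S -> Prop) :
  right_id (pres_one R) (@pres_mul S R).
Proof. by move=> x; rewrite -(pres_classK x) pres_mulE cats0. Qed.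

Lemma pres_mulV (S : choiceType) (R : gword S -> Prop) :
  left_inverse (pres_one R) (@pres_inv S R) (@pres_mul S R).
Proof.
move=> x; rewrite -(pres_classK x) pres_invE pres_mulE.
exact/pres_classP/pres_equiv_invl.
Qed.

Lemma pres_mulrV (S : choiceType) (R : gword S -> Prop) :
  right_inverse (pres_one R) (@pres_inv S R) (@pres_mul S R).
Proof.
move=> x; rewrite -(pres_classK x) pres_invE pres_mulE.
by apply/pres_classP; rewrite -{1}[repr x]gword_invK; apply: pres_equiv_invl.
Qed.

HB.instance Definition _ (S : choiceType) (R : gword S -> Prop) :=
  isGroup.Build (presented_group R) (@pres_mulA S R) (@pres_mul1 S R)
    (@pres_mulr1 S R) (@pres_mulV S R) (@pres_mulrV S R).

Definition pres_gen (S : choiceType) (R : gword S -> Prop) (s : S) :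
  presented_group R := pres_class R (letter s).

(** * Graphs and right-angled Coxeter groups *)

Record simple_graph := SimpleGraph {
  vertex :> finType;
  adj : rel vertex;
  adj_sym : symmetric adj;
  adj_irrefl : irreflexive adj
}.

Definition regular (l : nat) (Gamma : simple_graph) :=
  forall v : Gamma, #|[set u | adj v u]| = l.

Definition triangle_free (Gamma : simple_graph) :=
  forall u v w : Gamma, ~~ [&& adj u v, adj v w & adj u w].

Inductive racg_relator (Gamma : simple_graph) : gword Gamma -> Prop :=
| racg_square (s : Gamma) : racg_relator (gword_exp (letter s) 2)
| racg_commute (s t : Gamma) : adj s t ->
    racg_relator (gword_exp (letter s ++ letter t) 2).

Definition racg (Gamma : simple_graph) : groupType :=
  presented_group (@racg_relator Gamma).

Definition racg_gen (Gamma : simple_graph) : Gamma -> racg Gamma :=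
  @pres_gen Gamma (@racg_relator Gamma).

(** * Formal power series *)

Definition fps (R : Type) := nat -> R.

Definition fps_poly (R : nzRingType) (p : {poly R}) : fps R :=
  fun n => (p`_n)%R.

Definition fps_mul (R : nzRingType) (f g : fps R) : fps R :=
  fun n => (\sum_(i < n.+1) f i * g (n - i)%N)%R.

(* The first [n] coefficients of the inverse of [f], obtained by solving
   [f * g = 1] degree by degree; meaningful when [f 0] is a unit. *)
Fixpoint fps_inv_seq (R : unitRingType) (f : fps R) (n : nat) : seq R :=
  if n is m.+1 then
    let s := fps_inv_seq f m in
    rcons s ((f 0)^-1 * ((m == 0)%:R - \sum_(i < m) f (m - i)%N * s`_i))%R
  else [::].

Definition fps_inv (R : unitRingType) (f : fps R) : fps R :=
  fun n => ((fps_inv_seq f n.+1)`_n)%R.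

Definition fps_div (R : unitRingType) (f g : fps R) : fps R :=
  fps_mul f (fps_inv g).

Lemma size_fps_inv_seq (R : unitRingType) (f : fps R) (n : nat) :
  size (fps_inv_seq f n) = n.
Proof. by elim: n => //= n IHn; rewrite size_rcons IHn. Qed.

Lemma nth_fps_inv_seq (R : unitRingType) (f : fps R) (n i : nat) :
  i < n -> ((fps_inv_seq f n)`_i = fps_inv f i)%R.
Proof.
elim: n => // n IHn; rewrite ltnS leq_eqVlt => /orP[/eqP-> //|lt_in].
by rewrite /= nth_rcons size_fps_inv_seq lt_in IHn.
Qed.

Lemma fps_mulV (R : unitRingType) (f : fps R) : f 0 \is a GRing.unit ->
  fps_mul f (fps_inv f) = fps_poly 1%R.
Proof.
move=> uf; apply: funext => n; rewrite /fps_mul /fps_poly coef1.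
rewrite big_ord_recl /= subn0 {1}/fps_inv /= nth_rcons size_fps_inv_seq.
rewrite ltnn eqxx mulrA mulrV // mul1r.
suff -> : (\sum_(i < n) f (n - i)%N * (fps_inv_seq f n)`_i =
           \sum_(i < n) f (bump 0 i) * fps_inv f (n - bump 0 i)%N)%R.
  by rewrite subrK.
rewrite (reindex_inj rev_ord_inj) /=; apply: eq_bigr => i _.
rewrite /bump add1n subKn // nth_fps_inv_seq //.
by rewrite ltn_subrL /=; apply: leq_ltn_trans (ltn_ord i).
Qed.

(** * Geodesic growth *)

(* Here [S] indexes the generators of [G]; words are words in the index set. *)
Definition word_eval (S : finType) (G : groupType) (gen : S -> G)
  (w : seq S) : G := (\prod_(s <- w) gen s)%g.

Definition has_word (S : finType) (G : groupType) (gen : S -> G) (g : G)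
  (r : nat) : bool := [exists w : r.-tuple S, word_eval gen w == g].

(* The 0 is a default for elements outside the submonoid generated by [gen];
   [geodesic_growth_series] only evaluates [word_length] at values of words,
   where the default is never used. *)
Definition word_length (S : finType) (G : groupType) (gen : S -> G) (g : G) :
  nat := if pselect (exists r, has_word gen g r) is left h then ex_minn h
         else 0.

Definition geodesic_growth_series (S : finType) (G : groupType)
  (gen : S -> G) : fps int := fun r =>
  (#|[set w : r.-tuple S | word_length gen (word_eval gen w) == r]|%:Z)%R.

(* Main.v *)
Require Import Defs.
From mathcomp Require Import all_boot all_order all_algebra.
From mathcomp Require Import boolp.
From mathcomp Require Import ring zify.

Set Implicit Arguments.
Unset Strict Implicit.
Unset Printing Implicit Defensive.

Import GRing.Theory.

(** The word problem in a right-angled Coxeter group is solved by a stack.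
    Keep a word written backwards, the most recent letter first.  To multiply
    by a generator [s], look for an occurrence of [s] that can be moved to the
    top of the stack through letters commuting with it: if there is one, delete
    it, otherwise put [s] on top.  Up to commutations ([shuffle]), this is an
    action of the group on the stacks to which no deletion was ever possible
    ([reduced]): see [push_push], [push_comm] and [push_gword_equiv].  Hence the
    height of the stack produced by a word depends only on the group element;
    it never exceeds the length of the word, and the stack, read from the
    bottom, spells the same element.  So this height is the word length
    ([word_length_racg]), and a word is geodesic exactly when no deletion
    occurs while it is read, that is, when its reversal is reduced.

    It remains to count reduced words.  The letters that may not be pushed on
    [w] form its right descent set [descent w], a clique, so that it has at most
    two elements when there are no triangles.  Put [c r] and [d r] for the
    number of reduced words of length [r] and for the sum of the sizes of their
    descent sets.  Each word has [n - #|descent w|] reduced extensions, so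
    [c r.+1 = n * c r - d r].  After pushing [s] the descent set consists of [s]
    and of the neighbours of [s] in [descent w].  Counting the pairs formed by
    such an [s] and a neighbour of it in [descent w] from the side of the
    neighbour, which has [l] neighbours, of which [#|descent w| - 1] lie in the
    clique, gives
    [d r.+1 = c r.+1 + l * d r - e r], where [e r] is the sum of
    [#|descent w| * (#|descent w| - 1)].  For nonempty [w] the descent set has
    one or two elements, and [k * (k - 1) = 2 * k - 2] for [k = 1, 2]; thus
    [e r = 2 * d r - 2 * c r] for [r > 0].  Eliminating [d] and [e] leaves
    a linear recurrence of order two for [c] from degree three on, whose
    coefficients are those of the denominator; the numerator records the first
    three degrees. *)

(** * Cancelling letters in words up to commutation *)

(** The head of [w] is the most recent letter: the occurrence of [s] that is
    deleted is the last one in reading order, provided that it commutes with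
    everything read after it. *)
Fixpoint cancel_letter (G : simple_graph) (s : G) (w : seq G) :
    option (seq G) :=
  if w is x :: w' then
    if x == s then Some w'
    else if adj s x then omap (cons x) (cancel_letter s w') else None
  else None.

Definition push (G : simple_graph) (w : seq G) (s : G) : seq G :=
  odflt (s :: w) (cancel_letter s w).

Fixpoint reduced (G : simple_graph) (w : seq G) : bool :=
  if w is s :: w' then ~~ cancel_letter s w' && reduced w' else true.

(** Equivalence of words in the partially commutative monoid of [G]. *)
Inductive shuffle (G : simple_graph) : seq G -> seq G -> Prop :=
| shuffle_refl w : shuffle w w
| shuffle_sym u v : shuffle u v -> shuffle v u
| shuffle_trans u v w : shuffle u v -> shuffle v w -> shuffle u w
| shuffle_cons x u v : shuffle u v -> shuffle (x :: u) (x :: v)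
| shuffle_swap x y w : adj x y -> shuffle (x :: y :: w) (y :: x :: w).

Definition oshuffle (G : simple_graph) (o1 o2 : option (seq G)) : Prop :=
  match o1, o2 with
  | Some u, Some v => shuffle u v
  | None, None => True
  | _, _ => False
  end.

Lemma adj_neq (G : simple_graph) (s t : G) : adj s t -> (s == t) = false.
Proof. by apply: contraTF => /eqP->; rewrite adj_irrefl. Qed.

(** Whether [s] can be brought to the top depends only on the commutation
    class, and so does the class of what remains.  This is what makes [push]
    well defined on classes. *)
Lemma cancel_shuffle (G : simple_graph) (s : G) (u v : seq G) :
  shuffle u v -> oshuffle (cancel_letter s u) (cancel_letter s v).
Proof.
elim=> {u v} [w|u v _|u v w _ uv _ vw|x u v uv IH|x y w xy] /=.
- by case: cancel_letter => //= w'; apply: shuffle_refl.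
- by case: (cancel_letter s u) (cancel_letter s v) => [u'|] [v'|] //=;
     apply: shuffle_sym.
- case: (cancel_letter s u) (cancel_letter s v) (cancel_letter s w) uv vw
    => [u'|] [v'|] [w'|] //=; exact: shuffle_trans.
- case: ifP => // _; case: ifP => // _.
  by case: (cancel_letter s u) (cancel_letter s v) IH => [u'|] [v'|] //=;
     apply: shuffle_cons.
have yx : adj y x by rewrite adj_sym.
have [<-|ns] := eqVneq x s.
  by rewrite eq_sym (adj_neq xy) xy /=; apply: shuffle_refl.
have [<-|nt] := eqVneq y s; first by rewrite yx /=; apply: shuffle_refl.
case: (adj s x); case: (adj s y) => //=.
by case: (cancel_letter s w) => //= w'; apply: shuffle_swap.
Qed.

Lemma cancel_some (G : simple_graph) (s : G) (w w' : seq G) :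
  cancel_letter s w = Some w' -> shuffle w (s :: w').
Proof.
elim: w w' => //= x w IH w'; case: eqP => [-> [->]|_]; first exact: shuffle_refl.
case: ifP => // sx; case E: cancel_letter => [v|] //= [<-].
apply: shuffle_trans (shuffle_cons x (IH _ E)) _.
by apply: shuffle_swap; rewrite adj_sym.
Qed.

(** Swapping the two top letters [x] and [y] exchanges the two tests that they
    undergo, since neither letter blocks the other. *)
Lemma reduced_shuffle (G : simple_graph) (u v : seq G) :
  shuffle u v -> reduced u = reduced v.
Proof.
elim=> {u v} [//|u v _ -> //|u v w _ -> _ -> //|x u v uv IH|x y w xy] /=.
  by rewrite IH; have := cancel_shuffle x uv; do 2 case: cancel_letter.
have yx : adj y x by rewrite adj_sym.
rewrite xy yx (adj_neq xy) (adj_neq yx).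
by case: (cancel_letter x w); case: (cancel_letter y w).
Qed.

Lemma push_shuffle (G : simple_graph) (s : G) (u v : seq G) :
  shuffle u v -> shuffle (push u s) (push v s).
Proof.
move=> uv; rewrite /push; have := cancel_shuffle s uv.
by case: (cancel_letter s u) (cancel_letter s v) => [u'|] [v'|] //= _;
   apply: shuffle_cons.
Qed.

Lemma push_reduced (G : simple_graph) (s : G) (w : seq G) :
  reduced w -> reduced (push w s).
Proof.
rewrite /push; case E: cancel_letter => [v|] /= rw; last by rewrite E.
by have := reduced_shuffle (cancel_some E); rewrite rw => /esym /andP[].
Qed.

(** If [s] is deleted from the reduced word [w], leaving [v], then [s :: v] is
    reduced too, so no further [s] can be deleted from [v] and the second push
    puts [s] back. *)
Lemma push_push (G : simple_graph) (s : G) (w : seq G) :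
  reduced w -> shuffle (push (push w s) s) w.
Proof.
rewrite {2}/push; case E: cancel_letter => [v|] /= rw; last first.
  by rewrite /push /= eqxx; apply: shuffle_refl.
have ws := cancel_some E; have := reduced_shuffle ws; rewrite rw /push /=.
by case: cancel_letter => //= _; apply: shuffle_sym.
Qed.

(** Neither letter blocks the other, so whether [s] is deleted or added does
    not depend on whether [t] was treated before. *)
Lemma push_comm (G : simple_graph) (s t : G) (w : seq G) :
  adj s t -> shuffle (push (push w s) t) (push (push w t) s).
Proof.
move=> st; have ts : adj t s by rewrite adj_sym.
have [nst nts] := (adj_neq st, adj_neq ts).
rewrite {2 4}/push.
case Es: (cancel_letter s w) => [v|]; case Et: (cancel_letter t w) => [u|] /=.
- have := cancel_shuffle t (cancel_some Es).
  have := cancel_shuffle s (cancel_some Et).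
  rewrite Es Et /= st ts nst nts /push.
  case E1: (cancel_letter s u) => [x|] //=; case E2: (cancel_letter t v) => [y|] //=.
  move=> vx uy.
  have := cancel_shuffle t vx; rewrite E2 /= eqxx /=.
  done.
- have := cancel_shuffle t (cancel_some Es).
  rewrite Et /push /= st ts nst nts Es /=; case: cancel_letter => //= _.
  exact: shuffle_refl.
- have := cancel_shuffle s (cancel_some Et).
  rewrite Es /push /= st ts nst nts Et /=; case: cancel_letter => //= _.
  exact: shuffle_refl.
by rewrite /push /= st ts nst nts Es Et /=; apply: shuffle_swap.
Qed.

(** * Word length in a right-angled Coxeter group *)

Definition normal_form (G : simple_graph) (w : seq G) : seq G :=
  foldl (@push G) [::] w.

(** Each generator is its own inverse, so a formal inverse acts as the letter
    itself. *)
Definition push_gword (G : simple_graph) (w : seq G) (u : gword G) : seq G :=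
  foldl (@push G) w (map fst u).

Lemma push_gword_cat (G : simple_graph) (w : seq G) (u v : gword G) :
  push_gword w (u ++ v) = push_gword (push_gword w u) v.
Proof. by rewrite /push_gword map_cat foldl_cat. Qed.

Lemma push_gword_reduced (G : simple_graph) (w : seq G) (u : gword G) :
  reduced w -> reduced (push_gword w u).
Proof.
rewrite /push_gword; elim: u w => //= a u IH w rw.
exact/IH/push_reduced.
Qed.

Lemma push_gword_shuffle (G : simple_graph) (w w' : seq G) (u : gword G) :
  shuffle w w' -> shuffle (push_gword w u) (push_gword w' u).
Proof.
rewrite /push_gword; elim: u w w' => //= a u IH w w' ww'.
exact/IH/push_shuffle.
Qed.

Lemma push_gword_relator (G : simple_graph) (w : seq G) (r : gword G) :
  racg_relator r -> reduced w -> shuffle (push_gword w r) w.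
Proof.
case=> [s|s t st] rw; rewrite /push_gword /=; first exact: push_push.
apply: shuffle_trans (push_push t rw).
apply/push_shuffle/(shuffle_trans (push_shuffle s (push_comm w st))).
exact/push_push/push_reduced.
Qed.

(** The group acts on commutation classes of reduced words: the defining
    relations, and the cancellation of formal inverses, act trivially. *)
Lemma push_gword_equiv (G : simple_graph) (u v : gword G) (w : seq G) :
  pres_equiv (@racg_relator G) u v -> reduced w ->
  shuffle (push_gword w u) (push_gword w v).
Proof.
move=> uv; elim: uv w => {u v} [u|u v _ IH|u v x _ IH1 _ IH2|u a v|u r v Rr] w rw.
- exact: shuffle_refl.
- exact/shuffle_sym/IH.
- exact: shuffle_trans (IH1 w rw) (IH2 w rw).
- rewrite !push_gword_cat; apply: push_gword_shuffle.
  exact/push_push/push_gword_reduced.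
- rewrite !push_gword_cat; apply: push_gword_shuffle.
  exact/push_gword_relator/push_gword_reduced.
Qed.

Lemma shuffle_size (G : simple_graph) (u v : seq G) :
  shuffle u v -> size u = size v.
Proof.
by elim=> {u v} [//|u v _ ->|u v w _ -> _ ->|x u v _ /= ->|].
Qed.

Lemma size_push (G : simple_graph) (s : G) (w : seq G) :
  size (push w s) = if cancel_letter s w then (size w).-1 else (size w).+1.
Proof.
rewrite /push; case E: cancel_letter => [v|] //=.
by rewrite (shuffle_size (cancel_some E)).
Qed.

Lemma normal_form_rcons (G : simple_graph) (s : G) (w : seq G) :
  normal_form (rcons w s) = push (normal_form w) s.
Proof. exact: foldl_rcons. Qed.

Lemma size_normal_form (G : simple_graph) (w : seq G) :
  size (normal_form w) <= size w.
Proof.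
elim/last_ind: w => // w s IH; rewrite normal_form_rcons size_push size_rcons.
by case: cancel_letter => [v|//] /=; rewrite (leq_trans (leq_pred _)) // leqW.
Qed.

Lemma normal_form_id (G : simple_graph) (w : seq G) :
  reduced w -> normal_form (rev w) = w.
Proof.
elim: w => //= s w IH /andP[sw rw].
by rewrite rev_cons normal_form_rcons IH // /push; case: cancel_letter sw.
Qed.

Lemma reduced_normal_form (G : simple_graph) (w : seq G) :
  reduced (normal_form w).
Proof.
by elim/last_ind: w => // w s IH; rewrite normal_form_rcons push_reduced.
Qed.

(** A deletion makes the stack strictly lower than the number of letters read,
    and the loss is never recovered. *)
Lemma size_normal_form_eq (G : simple_graph) (w : seq G) :
  (size (normal_form w) == size w) = reduced (rev w).
Proof.
apply/idP/idP=> [|rw]; last by rewrite -{1}[w]revK normal_form_id // size_rev.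
suff H: size (normal_form w) = size w -> normal_form w = rev w.
  by move/eqP/H <-; apply: reduced_normal_form.
elim/last_ind: w => // w s IH.
rewrite normal_form_rcons size_push size_rcons rev_rcons /push.
case: cancel_letter => [v|] /=; last by case=> /IH ->.
have := size_normal_form w; case: (size (normal_form w)) => //= k kw E.
by rewrite E ltnNge leqnSn in kw.
Qed.

Lemma word_eval_rcons (G : simple_graph) (w : seq G) (s : G) :
  word_eval (@racg_gen G) (rcons w s) =
  (word_eval (@racg_gen G) w * racg_gen s)%g.
Proof. by rewrite /word_eval -cats1 big_cat big_seq1. Qed.

Lemma word_evalE (G : simple_graph) (w : seq G) :
  word_eval (@racg_gen G) w =
  pres_class (@racg_relator G) [seq (s, false) | s <- w].
Proof.
elim/last_ind: w => [|w s IH]; first by rewrite /word_eval big_nil.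
by rewrite word_eval_rcons IH map_rcons -cats1 -pres_mulE.
Qed.

Lemma racg_gen_sqr (G : simple_graph) (s : G) :
  (racg_gen s * racg_gen s = 1)%g.
Proof.
rewrite [LHS]pres_mulE; apply/pres_classP.
exact: (pres_relator [::] [::] (racg_square s)).
Qed.

Lemma racg_gen_comm (G : simple_graph) (s t : G) : adj s t ->
  (racg_gen s * racg_gen t = racg_gen t * racg_gen s)%g.
Proof.
move=> st; have V x : (racg_gen x)^-1%g = racg_gen x :> racg G.
  exact/mulg1_eq/racg_gen_sqr.
suff : (racg_gen s * racg_gen t * (racg_gen s * racg_gen t) = 1 :> racg G)%g.
  by move/mulg1_eq <-; rewrite invgM !V.
rewrite [X in (X * _)%g]pres_mulE [X in (_ * X)%g]pres_mulE [LHS]pres_mulE.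
apply/pres_classP.
exact: (pres_relator [::] [::] (racg_commute st)).
Qed.

Lemma word_eval_shuffle (G : simple_graph) (u v : seq G) : shuffle u v ->
  word_eval (@racg_gen G) (rev u) = word_eval (@racg_gen G) (rev v).
Proof.
elim=> {u v} [//|u v _ -> //|u v w _ -> _ -> //|x u v _ IH|x y w xy].
  by rewrite !rev_cons !word_eval_rcons IH.
by rewrite !rev_cons !word_eval_rcons -!mulgA racg_gen_comm 1?adj_sym.
Qed.

Lemma word_eval_normal_form (G : simple_graph) (w : seq G) :
  word_eval (@racg_gen G) (rev (normal_form w)) = word_eval (@racg_gen G) w.
Proof.
elim/last_ind: w => // w s IH; rewrite normal_form_rcons word_eval_rcons -IH.
rewrite /push; case E: cancel_letter => [v|] /=.
  rewrite (word_eval_shuffle (cancel_some E)) rev_cons word_eval_rcons.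
  by rewrite -mulgA racg_gen_sqr mulg1.
by rewrite rev_cons word_eval_rcons.
Qed.

Lemma size_normal_form_eval (G : simple_graph) (u v : seq G) :
  word_eval (@racg_gen G) u = word_eval (@racg_gen G) v ->
  size (normal_form u) = size (normal_form v).
Proof.
rewrite !word_evalE => /pres_classP uv.
have := shuffle_size (push_gword_equiv (w := [::]) uv isT).
have K (w : seq G) : map fst [seq (s, false) | s <- w] = w.
  by rewrite -map_comp map_id.
by rewrite /push_gword !K.
Qed.

(** The reversed normal form is a word of this length for the same element,
    and any other word for it has a normal form of the same size, which bounds
    its own length from below. *)
Lemma word_length_racg (G : simple_graph) (w : seq G) :
  word_length (@racg_gen G) (word_eval (@racg_gen G) w) =
  size (normal_form w).
Proof.
have hw : has_word (@racg_gen G) (word_eval (@racg_gen G) w)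
                   (size (normal_form w)).
  apply/existsP; exists (rev_tuple (in_tuple (normal_form w))).
  by rewrite /= word_eval_normal_form.
rewrite /word_length; case: pselect => [h|[]]; last by exists (size (normal_form w)).
case: ex_minnP => m /existsP[u /eqP uw] /(_ _ hw) mw; apply/eqP.
rewrite eqn_leq mw -(size_normal_form_eval uw).
by rewrite (leq_trans (size_normal_form u)) ?size_tuple.
Qed.

Lemma geodesic_reduced (G : simple_graph) (r : nat) :
  #|[set w : r.-tuple G | word_length (@racg_gen G)
      (word_eval (@racg_gen G) w) == r]| =
  #|[set w : r.-tuple G | reduced w]|.
Proof.
have rK : involutive (fun w : r.-tuple G => rev_tuple w).
  by move=> w; apply: val_inj; apply: revK.
rewrite -[RHS](card_imset _ (inv_inj rK)); apply: eq_card => w.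
rewrite inE word_length_racg -{2}(size_tuple w) size_normal_form_eq.
apply/idP/imsetP => [rw|[u + ->]]; last by rewrite inE /= revK.
by exists (rev_tuple w); rewrite ?inE // rK.
Qed.

(** * Descent sets of reduced words *)

(** For reduced [w] this is the right descent set of the group element spelled
    by [rev w]: the generators that shorten it. *)
Definition descent (G : simple_graph) (w : seq G) : {set G} :=
  [set s | cancel_letter s w].

Lemma descent_cons (G : simple_graph) (s : G) (w : seq G) :
  descent (s :: w) = s |: [set t in descent w | adj t s].
Proof.
apply/setP=> t; rewrite !inE /= eq_sym; case: eqP => //= _.
by case: (adj t s); rewrite ?andbF //; case: cancel_letter.
Qed.

(** Two distinct letters that can both be brought to the top must pass each
    other. *)
Lemma descent_clique (G : simple_graph) (w : seq G) (t u : G) :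
  t \in descent w -> u \in descent w -> t != u -> adj t u.
Proof.
elim: w => [|s w IH]; first by rewrite inE.
rewrite descent_cons => /setU1P[->|/setIdP[tw ts]] /setU1P[->|/setIdP[uw us]] //.
- by rewrite eqxx.
- by rewrite adj_sym.
exact: IH.
Qed.

Lemma card_descent_le2 (G : simple_graph) (w : seq G) :
  triangle_free G -> #|descent w| <= 2.
Proof.
move=> tf; rewrite leqNgt; apply/card_gt2P => -[x [y [z [[xw yw zw] [xy yz zx]]]]].
have /negP := tf x y z; apply; apply/and3P; split.
- exact: descent_clique xw yw xy.
- exact: descent_clique yw zw yz.
by rewrite adj_sym; exact: descent_clique zw xw zx.
Qed.

(** Both sides agree because a descent set has one or two elements when the
    word is nonempty, and 1 and 2 are the roots of [k * (k - 1) + 2 = 2 * k]. *)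
Lemma card_descent_cons (G : simple_graph) (s : G) (w : seq G) :
  triangle_free G ->
  #|descent (s :: w)| * #|descent (s :: w)|.-1 + 2 = 2 * #|descent (s :: w)|.
Proof.
move=> /(card_descent_le2 (s :: w)).
have : 0 < #|descent (s :: w)|.
  by apply/card_gt0P; exists s; rewrite descent_cons setU11.
by case: #|_| => [|[|[|]]].
Qed.

(** The other elements of the clique [descent w] are exactly the neighbours
    of [t] that lie in it. *)
Lemma card_ascent_neighbours (G : simple_graph) (l : nat) (w : seq G) (t : G) :
  regular l G -> t \in descent w ->
  #|[set s | s \notin descent w & adj t s]| + #|descent w|.-1 = l.
Proof.
move=> reg tw; rewrite -(reg t) -(cardsID (descent w) [set u | adj t u]) addnC.
congr (_ + _); last by apply: eq_card => s; rewrite !inE.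
rewrite (cardsD1 t) tw /=; apply: eq_card => u; rewrite !in_setI !inE.
have [->|ut] := eqVneq u t; first by rewrite adj_irrefl.
apply/andP/andP => [[_ uw]|[_ uw]]; split=> //.
by apply: (descent_clique tw); [rewrite inE | rewrite eq_sym].
Qed.

(** Double counting of the adjacent pairs [(s, t)] with [s] outside and [t]
    inside [descent w]: for fixed [s] they are the old letters that survive in
    [descent (s :: w)]; for fixed [t] they are counted by
    [card_ascent_neighbours]. *)
Lemma sum_card_descent_cons (G : simple_graph) (l : nat) (w : seq G) :
  regular l G ->
  \sum_(s | s \notin descent w) #|descent (s :: w)|
    + #|descent w| * #|descent w|.-1
  = \sum_(s | s \notin descent w) 1 + l * #|descent w|.
Proof.
move=> reg.
have -> : \sum_(s | s \notin descent w) #|descent (s :: w)| =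
    \sum_(s | s \notin descent w) 1 +
    \sum_(t in descent w) #|[set s | s \notin descent w & adj t s]|.
  under [X in _ = _ + X]eq_bigr => t _.
    rewrite -sum1_card (eq_bigl (fun s => (s \notin descent w) && adj t s)).
      over.
    by move=> s; rewrite inE.
  rewrite (exchange_big_dep (fun s => s \notin descent w)) /=; last first.
    by move=> t s _ /andP[].
  rewrite -big_split /=; apply: eq_bigr => s sw.
  rewrite descent_cons cardsU1 !inE adj_irrefl andbF /=; congr (_ + _).
  rewrite -sum1_card; apply: eq_bigl => t.
  by move: sw; rewrite !inE => ->.
rewrite -addnA; congr (_ + _).
rewrite -sum_nat_const -big_split /= mulnC -sum_nat_const.
by apply: eq_bigr => t; apply: card_ascent_neighbours.
Qed.

(** * Counting reduced words *)

Definition reduced_sum (G : simple_graph) (F : seq G -> nat) (r : nat) : nat :=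
  \sum_(w : r.-tuple G | reduced w) F w.

Lemma reduced_sumS (G : simple_graph) (F : seq G -> nat) (r : nat) :
  reduced_sum F r.+1 =
  reduced_sum (fun w => \sum_(s | s \notin descent w) F (s :: w)) r.
Proof.
rewrite /reduced_sum pair_big_dep /=.
rewrite (reindex (fun p : r.-tuple G * G => [tuple of p.2 :: p.1])) /=.
  by apply: eq_bigl => -[w s] /=; rewrite inE andbC.
exists (fun u => (behead_tuple u, thead u)) => [[w s] _|u _] /=.
  by congr pair; apply: val_inj.
by rewrite -tuple_eta.
Qed.

Lemma reduced_sum_count (G : simple_graph) (r : nat) :
  reduced_sum (fun _ : seq G => 1) r.+1 +
    reduced_sum (fun w : seq G => #|descent w|) r =
  #|G| * reduced_sum (fun _ : seq G => 1) r.
Proof.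
rewrite reduced_sumS -big_split /= big_distrr /=; apply: eq_bigr => w _.
by rewrite muln1 -(cardC (mem (descent w))) addnC sum1_card.
Qed.

Lemma reduced_sum_descent (G : simple_graph) (l r : nat) : regular l G ->
  reduced_sum (fun w : seq G => #|descent w|) r.+1 +
    reduced_sum (fun w : seq G => #|descent w| * #|descent w|.-1) r =
  reduced_sum (fun _ : seq G => 1) r.+1 +
    l * reduced_sum (fun w : seq G => #|descent w|) r.
Proof.
move=> reg; rewrite !reduced_sumS /reduced_sum big_distrr -!big_split /=.
by apply: eq_bigr => w _; apply: sum_card_descent_cons.
Qed.

Lemma reduced_sum_pairs (G : simple_graph) (r : nat) : triangle_free G ->
  reduced_sum (fun w : seq G => #|descent w| * #|descent w|.-1) r.+1 +
    2 * reduced_sum (fun _ : seq G => 1) r.+1 =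
  2 * reduced_sum (fun w : seq G => #|descent w|) r.+1.
Proof.
move=> tf; rewrite /reduced_sum !big_distrr -big_split /=.
apply: eq_bigr => -[[//|s w] sw] _; exact: card_descent_cons.
Qed.

Lemma descent_nil (G : simple_graph) : descent ([::] : seq G) = set0.
Proof. by apply/setP=> s; rewrite !inE. Qed.

Lemma reduced_sum0 (G : simple_graph) (F : seq G -> nat) :
  reduced_sum F 0 = F [::].
Proof.
rewrite /reduced_sum (big_pred1 [tuple]) // => w.
by rewrite (tuple0 w) /= eqxx.
Qed.

(** * Division of formal power series *)

Local Open Scope ring_scope.

Definition fps_trunc (R : nzRingType) (N : nat) (f : fps R) : {poly R} :=
  \poly_(i < N) f i.

Lemma fps_mul_trunc (R : nzRingType) (f g : fps R) (N n : nat) : (n < N)%N ->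
  fps_mul f g n = (fps_trunc N f * fps_trunc N g)`_n.
Proof.
move=> nN; rewrite coefM; apply: eq_bigr => i _; rewrite !coef_poly.
by rewrite (leq_ltn_trans _ nN) ?leq_ord // (leq_ltn_trans _ nN) ?leq_subr.
Qed.

(** A coefficient of a product involves only finitely many coefficients of the
    factors, so associativity is inherited from polynomials. *)
Lemma fps_mulA (R : nzRingType) (f g h : fps R) :
  fps_mul f (fps_mul g h) = fps_mul (fps_mul f g) h.
Proof.
apply: funext => n.
transitivity ((fps_trunc n.+1 f * (fps_trunc n.+1 g * fps_trunc n.+1 h))`_n).
  rewrite coefM; apply: eq_bigr => i _.
  by rewrite coef_poly ltn_ord (fps_mul_trunc _ _ (N := n.+1)) // ltnS leq_subr.
rewrite mulrA coefM; apply: eq_bigr => i _.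
by rewrite coef_poly ltnS leq_subr (fps_mul_trunc _ _ (N := n.+1)).
Qed.

Lemma fps_mulr1 (R : nzRingType) (f : fps R) : fps_mul f (fps_poly 1) = f.
Proof.
apply: funext => n; rewrite /fps_mul /fps_poly big_ord_recr /= subnn.
rewrite coefC eqxx mulr1 big1 ?add0r // => i _.
by rewrite coefC subn_eq0 leqNgt ltn_ord mulr0.
Qed.

Lemma fps_div_eq (R : unitRingType) (f p q : fps R) :
  q 0%N \is a GRing.unit -> fps_mul f q = p -> f = fps_div p q.
Proof.
by move=> uq <-; rewrite /fps_div -fps_mulA fps_mulV // fps_mulr1.
Qed.

Lemma coef_quadratic (R : nzRingType) (a b c : R) (k : nat) :
  (a%:P + b%:P * 'X + c%:P * 'X^2)`_k =
  if k is k1.+1 then if k1 is k2.+1 then if k2 is 0%N then c else 0 else b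
  else a.
Proof.
rewrite !coefD coefC coefMX coefCM coefC coefXn.
by case: k => [|[|[|k]]] /=; rewrite ?mulr0 ?mulr1 ?addr0 ?add0r.
Qed.

Lemma fps_mul_quadratic (R : nzRingType) (f : fps R) (a b c : R) (n : nat) :
  fps_mul f (fps_poly (a%:P + b%:P * 'X + c%:P * 'X^2)) n.+2 =
  f n.+2 * a + f n.+1 * b + f n * c.
Proof.
rewrite /fps_mul /fps_poly !big_ord_recr /= subnn subSnn.
rewrite (_ : (n.+2 - n = 2)%N); last by lia.
rewrite !coef_quadratic big1 ?add0r => [|i _].
  by rewrite [RHS]addrC [X in _ = _ + X]addrC addrA.
rewrite coef_quadratic (_ : (n.+2 - i = (n - i.+1).+3)%N) ?mulr0 //.
by move: (ltn_ord i); lia.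
Qed.

(** * The growth series *)

Theorem theorem5p1 (Gamma : simple_graph) (l n : nat)
  (hreg : regular l Gamma) (htri : triangle_free Gamma)
  (hcard : #|Gamma| = n) (hn : (4 <= n)%N) :
  geodesic_growth_series (@racg_gen Gamma) =
  fps_div
    (fps_poly (1 - (l%:Z - 3)%:P * 'X + 2%:P * 'X^2))
    (fps_poly (1 + (- n%:Z - l%:Z + 3)%:P * 'X
                 + (- 2 * n%:Z + 2 + n%:Z * l%:Z)%:P * 'X^2)).
Proof.
pose c r := reduced_sum (fun _ : seq Gamma => 1%N) r.
pose d r := reduced_sum (fun w : seq Gamma => #|descent w|) r.
pose e r := reduced_sum (fun w : seq Gamma => #|descent w| * #|descent w|.-1)%N r.
have Gc : geodesic_growth_series (@racg_gen Gamma) = fun r => (c r)%:Z.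
  apply: funext => r; rewrite /geodesic_growth_series geodesic_reduced.
  by rewrite -sum1_card /c /reduced_sum; congr Posz; apply: eq_bigl => w; rewrite inE.
have cS r : (c r.+1 + d r = n * c r)%N by rewrite -hcard; apply: reduced_sum_count.
have dS r : (d r.+1 + e r = c r.+1 + l * d r)%N by apply: reduced_sum_descent.
have eS r : (e r.+1 + 2 * c r.+1 = 2 * d r.+1)%N by apply: reduced_sum_pairs.
have c0 : c 0 = 1%N by apply: reduced_sum0.
have d0 : d 0 = 0%N by rewrite /d reduced_sum0 descent_nil cards0.
have c1 : c 1%N = n by have := cS 0%N; rewrite d0 c0 addn0 muln1.
have e0 : e 0 = 0%N by rewrite /e reduced_sum0 descent_nil cards0.
rewrite -[1]/(1%:P) -mulNr -polyCN.
apply: fps_div_eq; first by rewrite /fps_poly coef_quadratic.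
rewrite {}Gc; apply: funext => -[|[|r]].
- by rewrite /fps_mul big_ord1 /fps_poly !coef_quadratic c0.
- rewrite /fps_mul !big_ord_recr big_ord0 /fps_poly /= !coef_quadratic.
  by rewrite c0 c1 subn0 subnn; ring.
rewrite fps_mul_quadratic /fps_poly coef_quadratic.
have c2 : (c r.+2)%:Z = n%:Z * (c r.+1)%:Z - (d r.+1)%:Z.
  by have := cS r.+1; lia.
have d1 : (d r.+1)%:Z = (c r.+1)%:Z + l%:Z * (d r)%:Z - (e r)%:Z.
  by have := dS r; lia.
rewrite c2 d1.
(* Degree two is separate: the empty word has an empty descent set, so
   [e 0 = 0] whereas [2 * d 0 - 2 * c 0] is -2; this discrepancy is the
   coefficient 2 of the numerator. *)
case: r {c2 d1} => [|r]; first by rewrite c1 d0 e0 c0 /=; ring.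
have -> : (e r.+1)%:Z = 2 * (d r.+1)%:Z - 2 * (c r.+1)%:Z.
  by have := eS r; lia.
have -> : (d r.+1)%:Z = n%:Z * (c r.+1)%:Z - (c r.+2)%:Z.
  by have := cS r.+1; lia.
by rewrite /=; ring.
Qed.
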